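(* Let $\mathbf{G}$ and $\mathbf{G}'$ be two MW-graphs such that $\mathbf{G}\sqsubseteq\mathbf{G}'$, i.e. there is an MW-homomorphism $\pi\colon\mathbf{G}\to\mathbf{G}'$. Then $$h_k(\mathbf{G})\le h_k(\mathbf{G}')\qquad\text{for all }k\in\mathbb{N}.$$
   Context: Graphs: a graph $G=(V,E,\partial)$ consists of disjoint, at most countable sets $V$ (vertices) and $E$ (edges), a map $\partial\colon E\to V\times V$, $\partial e=(\partial_-e,\partial_+e)$, and an involution $e\mapsto\bar e$ on $E$ with $e\neq\bar e$ and $\partial_\pm\bar e=\partial_\mp e$. Graphs may be finite or infinite; loops and multiple edges are allowed; $G$ need not be connected. With $E_v=\{e\in E:\partial_-e=v\}$, every degree $\deg(v)=|E_v|$ is finite. MW-graphs: a weight $w$ on $G$ is a pair of functions $w\colon V\to(0,\infty)$, $w\colon E\to(0,\infty)$; put $w(V_0)=\sum_{v\in V_0}w(v)$, $w(E_0)=\sum_{e\in E_0}w_e$ for $V_0\subset V$, $E_0\subset E$. The relative weight is assumed to be bounded: $\sup_{v\in V}w(E_v)/w(v)<\infty$. Fix a subgroup $R$ of $\mathbb{R}/2\pi\mathbb{Z}$. A magnetic potential is a map $\alpha\colon E\to R$ with $\alpha_{\bar e}=-\alpha_e$. A magnetic weighted graph (MW-graph) is a triple $\mathbf{G}=(G,\alpha,w)$. MW-homomorphisms: a graph homomorphism $\pi\colon G\to G'$ consists of maps $\pi\colon V\to V'$, $\pi\colon E\to E'$ with $\pi(\partial_\pm e)=\partial'_\pm(\pi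 e)$ for all $e\in E$. An MW-homomorphism $\pi\colon\mathbf{G}\to\mathbf{G}'$, where $\mathbf{G}=(G,\alpha,w)$ and $\mathbf{G}'=(G',\alpha',w')$, is a graph homomorphism with $\alpha_e=\alpha'_{\pi e}$ for all $e\in E$, $\sum_{v\in V,\pi(v)=v'}w(v)\ge w'(v')$ for all $v'\in V'$, and $\sum_{e\in E,\pi(e)=e'}w_e\le w'_{e'}$ for all $e'\in E'$. Cheeger constants: the frustration index of $\mathbf{G}$ is $\iota(\mathbf{G})=\inf_{\tau\colon V\to R}\sum_{e\in E}w_e\bigl|\mathrm{e}^{\mathrm{i}\tau(\partial_+e)}-\mathrm{e}^{-\mathrm{i}\alpha_e}\mathrm{e}^{\mathrm{i}\tau(\partial_-e)}\bigr|$. For $V_0\subset V$, $\mathbf{G}[V_0]$ is the induced MW-subgraph with vertex set $V_0$, edge set $\{e\in E:\partial_-e,\partial_+e\in V_0\}$ and restricted $w,\alpha$. With $V_0^{\mathsf c}=V\setminus V_0$ and $E(V_0,V_0^{\mathsf c})=\{e\in E:\partial_-e\in V_0,\partial_+e\in V_0^{\mathsf c}\}$, set for non-empty $V_0\subset V$ $$h(\mathbf{G},V_0)=\frac{\iota(\mathbf{G}[V_0])+w(E(V_0,V_0^{\mathsf c}))}{w(V_0)}.$$ A $k$-subpartition of $V$ is a family $\{V_1,\dots,V_k\}$ of $k$ pairwise disjoint non-empty subsets of $V$; $\Pi_k(V)$ is the set of all of these. The $k$-th (magnetic weighted) Cheeger constant is $h_k(\mathbf{G})=\inf_{\Pi\in\Pi_k(V)}\sup_{V_0\in\Pi}h(\mathbf{G},V_0)$.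 *)

(* Defs.v *)
From HB Require Import structures.
From mathcomp Require Export all_boot all_order all_algebra.
From mathcomp Require Export all_classical all_reals all_analysis.
From mathcomp Require Export complex.

Set Implicit Arguments.
Unset Strict Implicit.
Unset Printing Implicit Defensive.

Import Order.TTheory GRing.Theory Num.Theory.

Local Open Scope classical_set_scope.
Local Open Scope ring_scope.
Local Open Scope quotient_scope.

Definition twopiZ (R : realType) : {pred R} :=
  fun x => x / (pi *+ 2) \is a Num.int.
Arguments twopiZ : clear implicits.

Lemma twopiZ_zmod_closed (R : realType) : zmod_closed (twopiZ R).
Proof.
split=> [|x y hx hy]; first by rewrite unfold_in mul0r int_num0.
by rewrite unfold_in mulrBl; exact: rpredB hx hy.
Qed.

HB.instance Definition _ (R : realType) :=
  GRing.isZmodClosed.Build R (twopiZ R) (@twopiZ_zmod_closed R).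

Notation angle R := (Quotient.quot (twopiZ R)).

Definition expi (R : realType) (a : angle R) : R[i] :=
  (cos (repr a) +i* sin (repr a))%C.

(* [expi] does not depend on the chosen representative. *)
Lemma expi_pi (R : realType) (x : R) :
  expi (\pi_(angle R) x) = (cos x +i* sin x)%C.
Proof.
rewrite /expi; have : x == repr (\pi_(angle R) x) %[mod angle R] by rewrite reprK.
rewrite -Quotient.idealrBE; set y := repr _ => /intrP[m hm].
have -> : x = y + (pi *+ 2) *~ m.
  rewrite -mulrzr -hm mulrC divfK; first by rewrite addrC subrK.
  by rewrite mulrn_eq0 /= gt_eqF ?pi_gt0.
suff [-> ->] : cos (y + (pi *+ 2) *~ m) = cos y /\
  sin (y + (pi *+ 2) *~ m) = sin y by [].
case: m {hm} => n.
  by rewrite -pmulrn (periodicn (@cosD2pi R)) (periodicn (@sinD2pi R)).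
rewrite NegzE mulrNz -pmulrn; set z := y - _.
by rewrite -(subrK (pi *+ 2 *+ n.+1) y) -/z (periodicn (@cosD2pi R))
  (periodicn (@sinD2pi R)).
Qed.

Record graph := Graph {
  vertex : countType;
  edge : countType;
  bd : edge -> vertex * vertex;
  inv : edge -> edge;
  invK : involutive inv;
  inv_neq : forall e, inv e != e;
  bd_inv : forall e, bd (inv e) = ((bd e).2, (bd e).1);
  finite_deg : forall v, finite_set [set e | (bd e).1 = v]
}.

Definition src (G : graph) (e : edge G) : vertex G := (bd e).1.
Definition tgt (G : graph) (e : edge G) : vertex G := (bd e).2.
Definition star (G : graph) (v : vertex G) : set (edge G) :=
  [set e | src e = v].

Definition mass (R : realType) (T : choiceType) (w : T -> R) (A : set T) :
  \bar R := (\esum_(x in A) (w x)%:E)%E.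

(* The magnetic potential takes values in the subgroup [S] of R/2piZ. *)
Record mwgraph (R : realType) (S : zmodClosed (angle R)) := MWGraph {
  graph_of :> graph;
  potential : edge graph_of -> angle R;
  vweight : vertex graph_of -> R;
  eweight : edge graph_of -> R;
  potential_in : forall e, potential e \in S;
  potential_inv : forall e, potential (inv e) = - potential e;
  vweight_gt0 : forall v, 0 < vweight v;
  eweight_gt0 : forall e, 0 < eweight e;
  bounded_relative_weight :
    (ereal_sup [set mass eweight (star v) / (vweight v)%:E
               | v in [set: vertex graph_of]] < +oo)%E
}.

Record graph_hom (G G' : graph) := GraphHom {
  hom_v : vertex G -> vertex G';
  hom_e : edge G -> edge G';
  hom_src : forall e, hom_v (src e) = src (hom_e e);
  hom_tgt : forall e, hom_v (tgt e) = tgt (hom_e e)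
}.

Definition is_mw_hom (R : realType) (S : zmodClosed (angle R))
    (G G' : mwgraph S) (p : graph_hom G G') : Prop :=
  [/\ forall e, potential e = potential (hom_e p e),
      forall v', ((vweight v')%:E <=
                   mass (@vweight R S G) [set v | hom_v p v = v'])%E &
      forall e', (mass (@eweight R S G) [set e | hom_e p e = e'] <=
                   (eweight e')%:E)%E].

Definition mw_below (R : realType) (S : zmodClosed (angle R))
  (G G' : mwgraph S) : Prop := exists p : graph_hom G G', is_mw_hom p.

Definition frustration (R : realType) (S : zmodClosed (angle R))
    (G : mwgraph S) : \bar R :=
  ereal_inf [set (\esum_(e in [set: edge G])
      (eweight e * ComplexField.Normc.normc (expi (tau (tgt e)) -
                          expi (- potential e) * expi (tau (src e))))%:E)%E
    | tau in [set tau : vertex G -> angle R | forall v, tau v \in S]].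

Section induced.
Variables (R : realType) (S : zmodClosed (angle R)) (G : mwgraph S).
Variable V0 : set (vertex G).

Definition inner_edges : set (edge G) :=
  [set e | src e \in V0 /\ tgt e \in V0].

Definition ind_bd (e : inner_edges) : V0 * V0 :=
  let h := set_mem (valP e) in
  (exist (fun v => v \in V0) (src (val e)) h.1,
   exist (fun v => v \in V0) (tgt (val e)) h.2).

Lemma inner_inv (e : inner_edges) : inv (val e) \in inner_edges.
Proof.
have /set_mem[h1 h2] := valP e; apply/mem_set.
by split; rewrite /src /tgt bd_inv.
Qed.

Definition ind_inv (e : inner_edges) : inner_edges :=
  exist (fun e => e \in inner_edges) (inv (val e)) (inner_inv e).

Lemma ind_invK : involutive ind_inv.
Proof. by move=> e; apply: val_inj; rewrite /= invK. Qed.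

Lemma ind_inv_neq e : ind_inv e != e.
Proof. by rewrite -val_eqE /= inv_neq. Qed.

Lemma ind_bd_inv e : ind_bd (ind_inv e) = ((ind_bd e).2, (ind_bd e).1).
Proof.
by congr pair; apply: val_inj; rewrite /= /src /tgt bd_inv.
Qed.

Lemma ind_star_sub (v : V0) :
  [set e | (ind_bd e).1 = v] `<=` val @^-1` (@star G (val v)).
Proof. by move=> e /= <-. Qed.

Lemma ind_finite_deg v : finite_set [set e | (ind_bd e).1 = v].
Proof.
apply: sub_finite_set (@ind_star_sub v) _; apply: finite_preimage.
  by move=> x y _ _; exact: val_inj.
exact: finite_deg.
Qed.

Definition induced_graph : graph :=
  @Graph V0 inner_edges ind_bd ind_inv ind_invK ind_inv_neq ind_bd_inv
    ind_finite_deg.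

Definition ind_potential (e : edge induced_graph) := potential (val e).
Definition ind_vweight (v : vertex induced_graph) := vweight (val v).
Definition ind_eweight (e : edge induced_graph) := eweight (val e).

Lemma ind_bounded :
  (ereal_sup [set mass ind_eweight (star v) / (ind_vweight v)%:E
             | v in [set: vertex induced_graph]] < +oo)%E.
Proof.
apply: le_lt_trans (bounded_relative_weight G).
apply: ge_ereal_sup => _ [v _ <-].
apply: le_trans; last by apply: ereal_sup_ubound; exists (val v).
rewrite lee_pmul2r //; last 2 first.
- by rewrite inver gt_eqF ?vweight_gt0.
- by rewrite inver gt_eqF ?vweight_gt0 // lte_fin invr_gt0 vweight_gt0.
rewrite /mass /ind_eweight.
rewrite -(@reindex_esum R _ _ (star v) (val @` star v) val
  (fun e => (eweight e)%:E)).
  apply: ereal_sup_le => _ [A [finA sA] <-]; exists A => //; split=> //.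
  by move=> e /sA[e' + <-]; exact: ind_star_sub.
by apply: inj_bij; move=> x y _ _; exact: val_inj.
Qed.

Definition induced : mwgraph S :=
  @MWGraph R S induced_graph ind_potential ind_vweight ind_eweight
    (fun e => potential_in (val e)) (fun e => potential_inv (val e))
    (fun v => vweight_gt0 (val v)) (fun e => eweight_gt0 (val e))
    ind_bounded.
End induced.

Definition edge_boundary (G : graph) (V0 : set (vertex G)) : set (edge G) :=
  [set e | V0 (src e) /\ (~` V0) (tgt e)].

(* A quotient of nonnegative extended reals.  The library would give
   +oo / +oo = +oo * 0 = 0; here the indeterminate quotient is +oo, so that sets
   of infinite mass and infinite numerator do not contribute to the infimum
   defining [cheeger]. *)
Definition ratio (R : realType) (x y : \bar R) : \bar R :=
  if (x == +oo%E) && (y == +oo%E) then +oo%E else (x / y)%E.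

Definition cheeger_ratio (R : realType) (S : zmodClosed (angle R))
    (G : mwgraph S) (V0 : set (vertex G)) : \bar R :=
  ratio (frustration (induced V0) + mass (@eweight R S G) (edge_boundary V0))%E
        (mass (@vweight R S G) V0).

Definition subpartition (T : Type) (k : nat) (P : 'I_k -> set T) : Prop :=
  (forall i, P i !=set0) /\ trivIset [set: 'I_k] P.

Definition cheeger (R : realType) (S : zmodClosed (angle R))
    (G : mwgraph S) (k : nat) : \bar R :=
  ereal_inf [set ereal_sup [set cheeger_ratio (P i) | i in [set: 'I_k]]
            | P in [set P : 'I_k -> set (vertex G) | subpartition P]].

(* Main.v *)
Require Import Defs.

Set Implicit Arguments.
Unset Strict Implicit.
Unset Printing Implicit Defensive.

Import Order.TTheory GRing.Theory Num.Theory.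

Local Open Scope classical_set_scope.
Local Open Scope ring_scope.
Local Open Scope ereal_scope.

(** The theorem holds because a [k]-subpartition of [G'] pulls back along an
    MW-homomorphism [p] to a [k]-subpartition of [G], and pulling back does not
    increase the ratio of any part. Let [V0] be a set of vertices of [G'].

    Summing fibre by fibre ([esum_preimage]), the conditions on the weights say
    that pulling back does not decrease the mass of a set of vertices
    ([le_vmass_preimage]) and does not increase that of a set of edges
    ([emass_preimage_le]). The boundary of the preimage of [V0] is the preimage
    of the boundary of [V0], so this settles the denominator and the second
    summand of the numerator of the ratio.

    For the first summand, [p] restricts to an MW-homomorphism between the
    induced subgraphs ([restrict_hom_mw]), so the frustration index has only to
    be compared for whole graphs ([frustration_le]). A gauge [tau] on the target
    pulls back to the gauge [tau \o p]; since [p] preserves the potential, the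
    defect of [tau \o p] at an edge is that of [tau] at its image, and each
    fibre of edges weighs at most the edge below it. Hence every competitor for
    the target bounds the frustration index of the source.

    The parts of the pulled back family are nonempty because a fibre of vertices
    has mass at least the positive weight of the vertex below it. *)

(** * Sums over fibres *)

Section fiberwise_sums.
Context {R : realType}.

Lemma esum_preimage (T U : choiceType) (f : T -> U) (a : T -> \bar R)
    (A : set U) : (forall x, 0 <= a x) ->
  \esum_(x in f @^-1` A) a x = \esum_(y in A) \esum_(x in f @^-1` [set y]) a x.
Proof.
move=> a0; rewrite esum_esum//.
apply: (@reindex_esum _ _ _ _ _ snd); split=> [[y x] /= [Ay fx]||x Ax].
- by rewrite fx.
- by move=> [y x] [z t] /set_mem[/= _ <-] /set_mem[/= _ <-] /= ->.
- by exists (f x, x).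
Qed.

Lemma esum_scale_le (T : choiceType) (A : set T) (w : T -> R) (c : R) :
  (0 <= c)%R -> (forall x, 0 <= w x)%R ->
  \esum_(x in A) (w x * c)%:E <= mass w A * c%:E.
Proof.
move=> c0 w0; apply: ge_ereal_sup => _ [X XA <-].
under eq_fsbigr do rewrite EFinM.
rewrite -ge0_mule_fsuml => [|x]; last by rewrite lee_fin.
by rewrite lee_wpmul2r ?lee_fin//; apply: ereal_sup_ubound; exists X.
Qed.

Lemma mass_val (T : choiceType) (A B : set T) (w : T -> R) : B `<=` A ->
  mass (fun x : A => w (val x)) (val @^-1` B) = mass w B.
Proof.
move=> BA; rewrite /mass -(@esum_image R _ _ _ val (fun x => (w x)%:E)).
  congr (esum _ _); apply/seteqP; split=> [_ [x Bx <-]//|x Bx].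
  by exists (exist _ x (mem_set (BA _ Bx))).
by move=> x y _ _; exact: val_inj.
Qed.

End fiberwise_sums.

(** * MW-homomorphisms *)

Section mw_hom.
Context {R : realType} {S : zmodClosed (angle R)}.
Implicit Types G : mwgraph S.

Lemma normc_ge0 (z : R[i]) : (0 <= ComplexField.Normc.normc z)%R.
Proof. by case: z => a b; exact: sqrtr_ge0. Qed.

Lemma frustration_ge0 G : 0 <= frustration G.
Proof.
apply: le_ereal_inf_tmp => _ [tau _ <-]; apply: esum_ge0 => e _.
by rewrite lee_fin mulr_ge0 ?(ltW (eweight_gt0 e))//; exact: normc_ge0.
Qed.

Context {G G' : mwgraph S} (p : graph_hom G G') (hp : is_mw_hom p).

Lemma le_vmass_preimage (A : set (vertex G')) :
  mass (@vweight R S G') A <= mass (@vweight R S G) (hom_v p @^-1` A).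
Proof.
have [_ hv _] := hp.
rewrite /mass [leRHS]esum_preimage => [|v]; last by rewrite lee_fin ltW ?vweight_gt0.
by apply: le_esum => v' _; exact: hv.
Qed.

Lemma emass_preimage_le (A : set (edge G')) :
  mass (@eweight R S G) (hom_e p @^-1` A) <= mass (@eweight R S G') A.
Proof.
have [_ _ he] := hp.
rewrite /mass [leLHS]esum_preimage => [|e]; last by rewrite lee_fin ltW ?eweight_gt0.
by apply: le_esum => e' _; exact: he.
Qed.

(** Fibres are nonempty since the empty set has mass [0]. *)
Lemma hom_v_surj (v' : vertex G') : exists v, hom_v p v = v'.
Proof.
have [_ hv _] := hp; apply: contrapT => /forallNP nv.
have := hv v'; rewrite (_ : [set v | _] = set0); last first.
  by apply/seteqP; split=> // v /= /nv.
by rewrite /mass esum_set0 lee_fin leNgt vweight_gt0.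
Qed.

Lemma frustration_le : frustration G <= frustration G'.
Proof.
have [hpot _ he] := hp.
apply: le_ereal_inf_tmp => _ [tau tauS <-].
pose c (e' : edge G') := ComplexField.Normc.normc
  (expi (tau (tgt e')) - expi (- potential e') * expi (tau (src e')))%R.
have c0 e' : (0 <= c e')%R by exact: normc_ge0.
apply: (@le_trans _ _ (\esum_(e in [set: edge G])
    (eweight e * c (hom_e p e))%:E)).
  apply: ereal_inf_lbound; exists (tau \o hom_v p) => [v /=//|].
  by apply: eq_esum => e _; rewrite /c -hpot -hom_src -hom_tgt.
rewrite -[X in esum X](preimage_setT (hom_e p)) esum_preimage => [|e];
  last first.
  by rewrite lee_fin mulr_ge0// ltW ?eweight_gt0.
apply: le_esum => e' _.
(* The defect is constant on the fibre of [e'], so it factors out. *)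
have -> : \esum_(e in hom_e p @^-1` [set e']) (eweight e * c (hom_e p e))%:E =
    \esum_(e in hom_e p @^-1` [set e']) (eweight e * c e')%:E.
  by apply: eq_esum => e /= ->.
apply: (le_trans (esum_scale_le _ (c0 e') _)) => [e|].
  by rewrite ltW ?eweight_gt0.
by rewrite EFinM lee_wpmul2r ?lee_fin//; exact: he.
Qed.

End mw_hom.

(** * Restriction to induced subgraphs *)

Section restriction.
Context {R : realType} {S : zmodClosed (angle R)} {G G' : mwgraph S}.
Context (p : graph_hom G G') (hp : is_mw_hom p) (V0 : set (vertex G')).

Let V := hom_v p @^-1` V0.

Definition restrict_v (v : vertex (induced V)) : vertex (induced V0) :=
  exist (fun v => v \in V0) (hom_v p (val v)) (mem_set (set_mem (valP v))).

Lemma hom_e_inner (e : edge (induced V)) : hom_e p (val e) \in inner_edges V0.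
Proof.
have /set_mem[/set_mem hs /set_mem ht] := valP e.
by apply/mem_set; split; apply/mem_set; rewrite -?hom_src -?hom_tgt.
Qed.

Definition restrict_e (e : edge (induced V)) : edge (induced V0) :=
  exist (fun e => e \in inner_edges V0) (hom_e p (val e)) (hom_e_inner e).

Lemma restrict_src e : restrict_v (src e) = src (restrict_e e).
Proof. by apply: val_inj; rewrite /= hom_src. Qed.

Lemma restrict_tgt e : restrict_v (tgt e) = tgt (restrict_e e).
Proof. by apply: val_inj; rewrite /= hom_tgt. Qed.

Definition restrict_hom : graph_hom (induced V) (induced V0) :=
  GraphHom restrict_src restrict_tgt.

(** Because the source is cut down to the full preimage of [V0], the fibres of
    the restriction are whole fibres of [p]; so the weight conditions carry
    over unchanged. *)
Lemma restrict_hom_mw : is_mw_hom restrict_hom.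
Proof.
have [hpot hv he] := hp; split=> [e|v'|e'].
- exact: hpot.
- rewrite (_ : [set v | _] = val @^-1` [set v | hom_v p v = val v']); last first.
    by apply/seteqP; split=> [v /= <-//|v /= pv]; exact: val_inj.
  rewrite /= /ind_vweight mass_val => [|v /= pv]; first exact: hv.
  by rewrite /V /preimage /= pv; exact: set_mem (valP v').
- rewrite (_ : [set e | _] = val @^-1` [set e | hom_e p e = val e']); last first.
    by apply/seteqP; split=> [e /= <-//|e /= pe]; exact: val_inj.
  rewrite /= /ind_eweight mass_val => [|e /= pe]; first exact: he.
  have /set_mem[/set_mem hs /set_mem ht] := valP e'.
  by split; apply/mem_set; rewrite /V /preimage /= ?hom_src ?hom_tgt pe.
Qed.

End restriction.

(** * Monotonicity of the Cheeger constants *)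

Lemma edge_boundary_preimage (G G' : graph) (p : graph_hom G G')
    (V0 : set (vertex G')) :
  edge_boundary (hom_v p @^-1` V0) = hom_e p @^-1` edge_boundary V0.
Proof.
by apply/seteqP; split=> e; rewrite /edge_boundary /preimage /= hom_src hom_tgt.
Qed.

(** The only delicate case is [x = y = +oo], where the quotient on the left is
    [+oo]: then [x'] is [+oo] too, and so is the quotient on the right, whether
    or not [y'] is finite. *)
Lemma le_ratio (R : realType) (x x' y y' : \bar R) :
  0 <= x -> x <= x' -> 0 < y' -> y' <= y -> ratio x y <= ratio x' y'.
Proof.
move=> x0 xx' y'0 y'y; rewrite /ratio.
have y0 : 0 <= y by exact: le_trans (ltW y'0) y'y.
case: (eqVneq x' +oo) => [x'y|x'y] /=.
  have [_|y'ny] := eqVneq y' +oo; first by rewrite leey.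
  by rewrite x'y gt0_mulye ?leey// inve_gt0// gt_eqF.
have -> : (x == +oo) = false.
  by apply/negbTE; apply: contraNneq x'y => xy; rewrite -leye_eq -xy.
apply: lee_pmul => //; first by rewrite inve_ge0.
by rewrite lee_pV2// inE// ltW.
Qed.

Section cheeger.
Context {R : realType} {S : zmodClosed (angle R)} {G G' : mwgraph S}.
Context (p : graph_hom G G') (hp : is_mw_hom p).

Lemma cheeger_ratio_preimage_le (V0 : set (vertex G')) : V0 !=set0 ->
  cheeger_ratio (hom_v p @^-1` V0) <= cheeger_ratio V0.
Proof.
move=> [v V0v]; apply: le_ratio.
- apply: adde_ge0; first exact: frustration_ge0.
  by apply: esum_ge0 => e _; rewrite lee_fin ltW ?eweight_gt0.
- apply: leeD; first exact: (frustration_le (restrict_hom_mw hp V0)).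
  by rewrite edge_boundary_preimage; exact: emass_preimage_le.
- apply: (@lt_le_trans _ _ (vweight v)%:E); first by rewrite lte_fin vweight_gt0.
  apply: esum_ge; exists [set v]; last by rewrite fsbig_set1.
  by split; [exact: finite_set1|move=> _ ->].
- exact: le_vmass_preimage.
Qed.

Lemma subpartition_preimage (k : nat) (P : 'I_k -> set (vertex G')) :
  subpartition P -> subpartition (fun i => hom_v p @^-1` P i).
Proof.
move=> [P0 Ptriv]; split=> [i|i j _ _ [v [Piv Pjv]]].
  have [v' Pv'] := P0 i; have [v pv] := hom_v_surj hp v'.
  by exists v; rewrite /= pv.
by apply: Ptriv => //; exists (hom_v p v).
Qed.

End cheeger.

Theorem theorem5p12 (R : realType) (S : zmodClosed (angle R))
    (G G' : mwgraph S) (hG : mw_below G G') (k : nat) :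
  (cheeger G k <= cheeger G' k)%E.
Proof.
have [p hp] := hG; apply: le_ereal_inf_tmp => _ [P Psub <-].
apply: (le_trans (ereal_inf_lbound _)).
  by exists (fun i => hom_v p @^-1` P i); [exact: subpartition_preimage|].
apply: ge_ereal_sup => _ [i _ <-].
apply: (le_trans (cheeger_ratio_preimage_le hp (Psub.1 i))).
by apply: ereal_sup_ubound; exists i.
Qed.
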